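(* Suppose that $d_j \in [0,1)$ for $j=1, \ldots, n$ and that $P$ is an $n \times n$ partial stochastic matrix with $p_{j,j}=d_j$, $j=1, \ldots, n$, and all other entries unspecified. Let $D=\mathrm{diag}(d_1, \ldots, d_n)$. Then a matrix $T$ satisfies $T \in SC(P)$ and $\mathcal{K}(T)=m(P)$ if and only if $T=D+(I-D)C$ for some cyclic permutation matrix $C$ for a cycle of length $n$ (i.e. $C$ is the $n\times n$ permutation matrix of a permutation of $\{1,\ldots,n\}$ consisting of a single $n$-cycle).
   Context: A stochastic matrix is a square, entrywise nonnegative real matrix each of whose row sums equals $1$. A partial matrix is one in which some entries are specified and the others are not; a completion is obtained by assigning values to all unspecified entries. A partial stochastic matrix is a partial matrix $P$ such that: (i) $P$ is square; (ii) all specified entries are nonnegative; (iii) in each row the sum of the specified entries is at most $1$, and it equals $1$ for any fully specified row; (iv) any row whose specified entries sum to $1$ is fully specified; (v) any row that is not fully specified contains at least two unspecified entries. $SC(P)$ denotes the set of all completions of $P$ that are stochastic matrices. The directed graph of an $n\times n$ stochastic matrix $T=[t_{i,j}]$ has vertices $1,\ldots,n$ and an arc $i\to j$ iff $t_{i,j}>0$. An index $j$ is essential if whenever there is a walk from $j$ to $k$ there is also a walk from $k$ to $j$. The essential indices are partitioned into essential classes: subsets within which any index can be reached from any other, and from which no index outside can be reached. $T$ has a single essential class if and only if $1$ is an algebraically simple eigenvalue of $T$. For a stochastic matrix $T$ of order $n$ with a single essential class and eigenvalues $1=\lambda_1,\lambda_2,\ldots,\lambda_n$ (with algebraic multiplicity),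 Kemeny's constant is $\mathcal{K}(T)=\sum_{j=2}^n \frac{1}{1-\lambda_j}$; it is only defined for such $T$, so the condition $\mathcal{K}(T)=m(P)$ includes that $T$ has a single essential class. If some stochastic completion of $P$ has a single essential class, $m(P)=\inf\{\mathcal{K}(T) : T\in SC(P),\ T \text{ has a single essential class}\}$. *)

(* Defs.v *)
From HB Require Import structures.
From mathcomp Require Import all_boot all_order all_algebra all_fingroup.
From mathcomp Require Import all_classical all_reals ereal.
From mathcomp Require Import complex.

Set Implicit Arguments.
Unset Strict Implicit.
Unset Printing Implicit Defensive.

Import Order.TTheory GRing.Theory Num.Theory.
Local Open Scope classical_set_scope.
Local Open Scope ring_scope.
Local Open Scope complex_scope.

Definition stochastic (R : realType) (n : nat) (T : 'M[R]_n) : Prop :=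
  (forall i j, 0 <= T i j) /\ (forall i, \sum_j T i j = 1).

(* A partial matrix is a matrix over [option R]; [None] marks the unspecified
   entries. *)
Definition specified (R : realType) (n : nat) (P : 'M[option R]_n)
    (i j : 'I_n) : bool := isSome (P i j).

Definition fully_specified (R : realType) (n : nat) (P : 'M[option R]_n)
    (i : 'I_n) : Prop := forall j, specified P i j.

Definition specified_sum (R : realType) (n : nat) (P : 'M[option R]_n)
    (i : 'I_n) : R := \sum_(j | specified P i j) odflt 0 (P i j).

Record partial_stochastic (R : realType) (n : nat) (P : 'M[option R]_n) : Prop :=
  PartialStochastic {
    specified_ge0 : forall i j x, P i j = Some x -> 0 <= x;
    specified_sum_le1 : forall i, specified_sum P i <= 1;
    specified_sum_full : forall i, fully_specified P i -> specified_sum P i = 1;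
    specified_sum_eq1 : forall i, specified_sum P i = 1 -> fully_specified P i;
    unspecified_ge2 : forall i, ~ fully_specified P i ->
      (2 <= #|[set j | ~~ specified P i j]%SET|)%N
  }.

Definition completion (R : realType) (n : nat) (P : 'M[option R]_n)
    (T : 'M[R]_n) : Prop := forall i j x, P i j = Some x -> T i j = x.

Definition SC (R : realType) (n : nat) (P : 'M[option R]_n) : set 'M[R]_n :=
  [set T | completion P T /\ stochastic T].

Definition arc (R : realType) (n : nat) (T : 'M[R]_n) : rel 'I_n :=
  fun i j => 0 < T i j.

Definition essential (R : realType) (n : nat) (T : 'M[R]_n) (j : 'I_n) : bool :=
  [forall k, connect (arc T) j k ==> connect (arc T) k j].

Definition essential_class (R : realType) (n : nat) (T : 'M[R]_n)
    (S : {set 'I_n}) : bool :=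
  [&& S != finset.set0,
      [forall i in S, essential T i],
      [forall i in S, forall j in S, connect (arc T) i j] &
      [forall i in S, forall j, connect (arc T) i j ==> (j \in S)]].

Definition single_essential_class (R : realType) (n : nat) (T : 'M[R]_n) : bool :=
  #|[set S | essential_class T S]%SET| == 1%N.

(* The complex eigenvalues of a real matrix, listed with their algebraic
   multiplicities as roots of the characteristic polynomial. *)
Definition eigenvalues (R : realType) (n : nat) (T : 'M[R]_n) : seq R[i] :=
  sval (closed_field_poly_normal (char_poly (map_mx (real_complex R) T))).

Lemma eigenvaluesP (R : realType) (n : nat) (T : 'M[R]_n) :
  char_poly (map_mx (real_complex R) T) =
    \prod_(z <- eigenvalues T) ('X - z%:P).
Proof.
rewrite /eigenvalues; case: closed_field_poly_normal => r /= {1}->.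
by rewrite (eqP (char_poly_monic _)) scale1r.
Qed.

(* [rem 1] discards a single occurrence of the eigenvalue 1.  The sum is real
   (lemma [kemenyE]); [Re] only brings it back into [R].  The value is
   meaningful only if [T] is stochastic with a single essential class. *)
Definition kemeny (R : realType) (n : nat) (T : 'M[R]_n) : R :=
  complex.Re (\sum_(z <- rem 1 (eigenvalues T)) (1 - z)^-1).

Lemma kemenyE (R : realType) (n : nat) (T : 'M[R]_n) :
  (kemeny T)%:C = \sum_(z <- rem 1 (eigenvalues T)) (1 - z)^-1.
Proof.
rewrite /kemeny; set s := eigenvalues T; set w := \sum_(z <- _) _.
have conjs : perm_eq (map conjc s) s.
  apply: prod_XsubC_eq; rewrite -eigenvaluesP big_map.
  transitivity (map_poly conjc (\prod_(z <- s) ('X - z%:P))).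
    rewrite rmorph_prod; apply: eq_bigr => z _ /=.
    by rewrite rmorphB /= map_polyX map_polyC.
  rewrite -eigenvaluesP map_char_poly; congr char_poly.
  by apply/matrixP => i j; rewrite !mxE; apply: conjc_real.
have conjr : perm_eq (map conjc (rem 1 s)) (rem 1 s).
  have [s1|s1] := boolP (1 \in s); last by rewrite !rem_id.
  rewrite -(perm_cons 1); apply: perm_trans (perm_to_rem s1).
  apply: perm_trans conjs; rewrite perm_sym.
  have e : map conjc (1 :: rem 1 s) = 1 :: map conjc (rem 1 s).
    by congr cons; apply: conjc1.
  by rewrite -e; apply: perm_map; apply: perm_to_rem.
suff: w^* = w.
  move/eqP; case: (w) => a b; rewrite eq_complex /= => /andP[_].
  by rewrite eqNr => /eqP->.
rewrite /w rmorph_sum -[RHS](perm_big _ conjr) big_map /=.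
by apply: eq_bigr => z _; rewrite fmorphV rmorphB rmorph1.
Qed.

(* An extended real, so that it is the true infimum whatever [P] is (+oo when no
   completion has a single essential class). *)
Definition kemeny_inf (R : realType) (n : nat) (P : 'M[option R]_n) : \bar R :=
  ereal_inf [set (kemeny T)%:E | T in
    [set T | SC P T /\ single_essential_class T]].

(* The decomposition of [s] into cycles, fixed points included, consists of one
   cycle through all the indices. *)
Definition cyclic_perm_mx (R : realType) (n : nat) (C : 'M[R]_n) : Prop :=
  exists s : 'S_n, porbits s = [set [set: 'I_n]]%SET /\ C = perm_mx s.

(* Main.v *)
Require Import Defs.
From mathcomp Require Import all_boot all_order all_algebra all_fingroup.
From mathcomp Require Import all_classical all_reals ereal.
From mathcomp Require Import complex ring lra.

Import Order.TTheory GRing.Theory Num.Theory.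
Local Open Scope ring_scope.

Set Implicit Arguments.
Unset Strict Implicit.
Unset Printing Implicit Defensive.

(** Write a_i = 1 - d_i, b_i = 1 / a_i, and T = D + (I - D) S, where S is
    stochastic: a chain with transition matrix T stays at i with probability
    d_i and otherwise jumps according to S.  Choosing independently for each i
    a target g(i) with law S(i, .) gives a random self-map g of the vertices,
    and since the determinant is multilinear in the rows,
      det((1 + y) I - T) = E_g [sum_A y^|A| prod_(i not in A) a_i [g: A]],
    where [g: A] is 1 if every vertex is led into A by iterating g, and 0
    otherwise ([char_poly_shift]).  This is a matrix-tree theorem: A is the set
    of roots of a forest.  The coefficients of y and y^2 determine Kemeny's
    constant, as it is the logarithmic derivative at 1 of the characteristic
    polynomial with one factor x - 1 removed ([kemeny_coef]).  Hence
      K(T) = E_g [sum_(i < k) b_i b_k [g: {i, k}]] / E_g [sum_i b_i [g: {i}]].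

    The minimum can now be found for each g separately.  Because
    [g: {i}] <= [g: {i, k}], a rearrangement of triple sums
    ([pair_average]) shows that the numerator is at least the denominator times
      sum_(i < k) b_i b_k / sum_i b_i,
    with equality if and only if [g: {i, k}] = [g: {i}] for all i != k.  So this
    ratio is a lower bound for K(T), attained exactly when every g that has
    positive probability satisfies these equalities ([kemeny_lazy_leif]).

    If T has a single essential class then some g of positive probability is a
    tree towards a root i ([single_class_tree]).  In the case of equality, g is
    then rooted at every vertex, that is, g is an n-cycle.  If S had another
    positive entry (j, l), redirecting j to l in g would give a map of positive
    probability still rooted at j, hence again an n-cycle; but l would have
    two preimages.  So S is the permutation matrix of g
    ([support_hamiltonian]).  Conversely, if S is the matrix of an n-cycle then
    that cycle is the only g that occurs, and it satisfies the equalities. *)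

(** * Determinants of functional graphs *)

Definition reaches (I : finType) (g : I -> I) (A : {set I}) (i : I) : bool :=
  [exists r in A, fconnect g i r].

(** Deleting the arcs that leave [A] from the graph of [g] then leaves a
    forest directed towards [A]. *)
Definition rooted (I : finType) (g : I -> I) (A : {set I}) : bool :=
  [forall i, reaches g A i].

Lemma reaches_root (I : finType) (g : I -> I) (A : {set I}) i :
  i \in A -> reaches g A i.
Proof. by move=> iA; apply/existsP; exists i; rewrite iA connect0. Qed.

Lemma reaches_step (I : finType) (g : I -> I) (A : {set I}) i :
  i \notin A -> reaches g A i = reaches g A (g i).
Proof.
move=> iA; apply/existsP/existsP => -[r /andP[rA ir]]; exists r; rewrite rA /=.
  move: (iter_findex ir) rA; case: (findex g i r) => [<-|m <- _].
    by rewrite (negbTE iA).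
  by rewrite iterSr fconnect_iter.
exact: connect_trans (fconnect1 g i) ir.
Qed.

(** The matrix is I - N, where N is the adjacency matrix of the graph of [g]
    with the arcs leaving [A] deleted.  A permutation other than the identity
    that contributes to its determinant moves the vertices of a union of cycles
    of [g] that avoid [A].  If [A] is reached from everywhere there are none,
    and only the identity contributes. *)
Lemma det_rooted (K : idomainType) (n : nat) (g : 'I_n -> 'I_n)
    (A : {set 'I_n}) :
  \det (\matrix_(i, j) ((i == j)%:R - (i \notin A)%:R * (g i == j)%:R))
    = (rooted g A)%:R :> K.
Proof.
set M := (\matrix_(_, _) _ : 'M[K]_n).
have ME i j : M i j = (i == j)%:R - (i \notin A)%:R * (g i == j)%:R.
  by rewrite mxE.
clearbody M.
have [/forallP gA|/forallPn[i0 ni0]] := boolP (rooted g A).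
  rewrite /determinant (bigD1 1%g) //= [X in _ + X]big1 ?addr0.
    rewrite odd_perm1 expr0 mul1r big1 // => i _; rewrite perm1 ME eqxx.
    have [iA|iA] := boolP (i \in A); first by rewrite mul0r subr0.
    have [gii|] := eqVneq (g i) i; last by rewrite mulr0 subr0.
    have /existsP[r /andP[rA ir]] := gA i.
    have itr m : iter m g i = i by elim: m => //= m ->.
    by move: rA iA; rewrite -(iter_findex ir) itr => ->.
  move=> s s1; apply/eqP/negPn/negP => prod_neq0.
  (* A factor that does not vanish off the diagonal sits at an arc of [g]. *)
  have moved i : s i != i -> (i \notin A) && (g i == s i).
    move=> sii; have: M i (s i) != 0.
      apply: contraNneq prod_neq0 => Mi0.
      by rewrite (bigD1 i) //= Mi0 mul0r mulr0.
    rewrite ME (eq_sym i) (negbTE sii) sub0r oppr_eq0.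
    by case: (i \in A); case: (g i == s i); rewrite ?(mul0r, mulr0) ?eqxx.
  have [i sii] : exists i, s i != i.
    apply/existsP; rewrite -negb_forall; apply: contra s1 => /forallP h.
    by apply/eqP/permP => i; rewrite perm1 (eqP (h i)).
  have itm m : s (iter m g i) != iter m g i.
    elim: m => //= m IH; have /andP[_ /eqP ->] := moved _ IH.
    by apply: contraNneq IH => /perm_inj ->.
  have /existsP[r /andP[rA ir]] := gA i.
  have /andP[] := moved _ (itm (findex g i r)).
  by rewrite (iter_findex ir) rA.
(* The indicator of the vertices that do not reach [A] is in the kernel. *)
apply/eqP; rewrite -det_tr; apply/det0P.
exists (\row_i (~~ reaches g A i)%:R).
  by apply/eqP => /rowP/(_ i0); rewrite !mxE ni0; apply/eqP/oner_neq0.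
apply/rowP => i; rewrite !mxE.
transitivity (\sum_j ((~~ reaches g A j)%:R * (i == j)%:R
   - (~~ reaches g A j)%:R * ((i \notin A)%:R * (g i == j)%:R)) : K).
  by apply: eq_bigr => j _; rewrite !mxE ME mulrBr.
rewrite sumrB (bigD1 i) //= eqxx mulr1 big1 ?addr0; last first.
  by move=> j ji; rewrite eq_sym (negbTE ji) mulr0.
rewrite (bigD1 (g i)) //= eqxx mulr1 big1 ?addr0; last first.
  by move=> j ji; rewrite eq_sym (negbTE ji) !mulr0.
have [iA|iA] := boolP (i \in A); first by rewrite reaches_root // mulr0 subr0.
by rewrite -reaches_step // mulr1 subrr.
Qed.

(** Multilinearity of the determinant: when each row is a combination of
    vectors indexed by [O], one may choose an index independently in each
    row. *)
Lemma det_mixture (K : comNzRingType) (O : finType) (n : nat)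
    (w : 'I_n -> O -> K) (v : 'I_n -> O -> 'I_n -> K) :
  \det (\matrix_(i, j) \sum_o w i o * v i o j)
    = \sum_(f : {ffun 'I_n -> O})
        (\prod_i w i (f i)) * \det (\matrix_(i, j) v i (f i) j).
Proof.
rewrite /determinant; under eq_bigr do under eq_bigr do rewrite mxE.
under eq_bigr do rewrite bigA_distr_bigA big_distrr /=.
rewrite exchange_big /=; apply: eq_bigr => f _.
rewrite big_distrr /=; apply: eq_bigr => s _.
rewrite big_split /= mulrCA; congr (_ * (_ * _)).
by apply: eq_bigr => i _; rewrite mxE.
Qed.

(** Row i is y times a unit vector plus a_i times a Laplacian row, and
    multilinearity chooses one of the two; [A] is the set of rows where the
    first is chosen. *)
Lemma det_forest (K : idomainType) (n : nat) (a : 'I_n -> K) (y : K)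
    (g : 'I_n -> 'I_n) :
  \det (\matrix_(i, j) (y * (i == j)%:R + a i * ((i == j)%:R - (g i == j)%:R)))
    = \sum_(A : {set 'I_n}) y ^+ #|A| * (\prod_(i | i \notin A) a i)
        * (rooted g A)%:R.
Proof.
transitivity (\det (\matrix_(i, j) \sum_(o : bool) (if o then y else a i) *
   ((i == j)%:R - (~~ o)%:R * (g i == j)%:R))).
  congr (\det _); apply/matrixP => i j; rewrite !mxE big_bool /=.
  by rewrite mul0r subr0 mul1r.
rewrite det_mixture (reindex_onto (fun A : {set 'I_n} => [ffun i => i \in A])
   (fun f => [set i | f i]%SET)) /=; last first.
  by move=> f _; apply/ffunP => i; rewrite ffunE inE.
apply: eq_big => [A|A _]; first by rewrite (_ : [set i | _]%SET = A) ?eqxx //;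
  apply/setP => i; rewrite inE ffunE.
rewrite -(det_rooted K g A); congr (_ * _); last first.
  by congr (\det _); apply/matrixP => i j; rewrite !mxE ffunE.
rewrite (bigID (mem A)) /= -prodr_const; congr (_ * _).
  by apply: eq_bigr => i iA; rewrite ffunE iA.
by apply: eq_bigr => i iA; rewrite ffunE (negbTE iA).
Qed.

(** * Kemeny's constant as a ratio of forest sums *)

(** As the rows of [S] sum to 1, row i of (1 + X) I - T is the average with
    weights [S i o] of the rows that one gets from the map sending i to o. *)
Lemma char_poly_shift (R : idomainType) (n : nat) (a : 'I_n -> R)
    (S T : 'M[R]_n) (S1 : forall i, \sum_j S i j = 1)
    (TE : forall i j, T i j = (i == j)%:R - a i * ((i == j)%:R - S i j)) :
  char_poly T \Po ('X + 1%:P) = \sum_(g : {ffun 'I_n -> 'I_n})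
    (\prod_i S i (g i))%:P * \sum_(A : {set 'I_n})
      'X^#|A| * (\prod_(i | i \notin A) (a i)%:P) * (rooted g A)%:R.
Proof.
transitivity (\det (\matrix_(i, j) \sum_o (S i o)%:P *
    ('X * (i == j)%:R + (a i)%:P * ((i == j)%:R - (o == j)%:R)))); last first.
  rewrite det_mixture; apply: eq_bigr => g _.
  by rewrite rmorph_prod /= -det_forest.
rewrite /char_poly -[LHS](det_map_mx (comp_poly ('X + 1%:P))).
congr (\det _); apply/matrixP => i j; rewrite !mxE /=.
have -> : \sum_o (S i o)%:P * ('X * (i == j)%:R
    + (a i)%:P * ((i == j)%:R - (o == j)%:R))
  = \sum_o ((S i o)%:P * ('X * (i == j)%:R + (a i)%:P * (i == j)%:R)
     - (a i)%:P * ((S i o)%:P * (o == j)%:R)) :> {poly R}.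
  by apply: eq_bigr => o _; ring.
rewrite sumrB -mulr_suml -mulr_sumr -(rmorph_sum (@polyC R)) S1 /=.
rewrite [X in _ - _ * X](bigD1 j) //= eqxx big1; last first.
  by move=> o oj; rewrite (negbTE oj) mulr0.
rewrite TE rmorphB rmorphMn /= comp_polyX comp_polyC !(rmorphB, rmorphM) /=.
by case: (i == j) => /=; rewrite ?(rmorph1, rmorph0) /=; ring.
Qed.

Lemma coef_char_poly_shift (R : idomainType) (n : nat) (a : 'I_n -> R)
    (S T : 'M[R]_n) (S1 : forall i, \sum_j S i j = 1)
    (TE : forall i j, T i j = (i == j)%:R - a i * ((i == j)%:R - S i j)) k :
  (char_poly T \Po ('X + 1%:P))`_k = \sum_(g : {ffun 'I_n -> 'I_n})
    (\prod_i S i (g i)) * \sum_(A : {set 'I_n} | #|A| == k)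
      (\prod_(i | i \notin A) a i) * (rooted g A)%:R.
Proof.
rewrite (char_poly_shift S1 TE) coef_sum; apply: eq_bigr => g _.
rewrite coefCM coef_sum; congr (_ * _); rewrite [RHS]big_mkcond /=.
apply: eq_bigr => A _.
rewrite -rmorph_prod /= -mulrA -polyC_natr -rmorphM /= mulrC coefCM coefXn.
by rewrite eq_sym; case: eqP; rewrite (mulr1, mulr0).
Qed.

Lemma big_card1 (V : zmodType) (I : finType) (F : {set I} -> V) :
  \sum_i F [set i]%SET = \sum_(A : {set I} | #|A| == 1) F A.
Proof.
rewrite (partition_big (fun i => [set i]%SET)
   (fun A : {set I} => #|A| == 1)) /=.
  apply: eq_bigr => A /cards1P[x ->].
  by rewrite (big_pred1 x) // => i; rewrite (inj_eq finset.set1_inj).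
by move=> i _; rewrite cards1.
Qed.

Lemma big_card2 (V : zmodType) (I : finType) (F : {set I} -> V) :
  \sum_i \sum_(k | k != i) F [set i; k]%SET
    = (\sum_(A : {set I} | #|A| == 2) F A) *+ 2.
Proof.
rewrite -sumrMnl pair_big_dep /=.
rewrite (partition_big (fun p : I * I => [set p.1; p.2]%SET)
   (fun A => #|A| == 2)) /=; last first.
  by move=> [i k] /= ki; rewrite cards2 (eq_sym i) ki.
apply: eq_bigr => A /cards2P[x [y [xy ->]]].
rewrite (bigD1 (x, y)) /=; last by rewrite eqxx eq_sym xy.
rewrite (bigD1 (y, x)) /=; last first.
  by rewrite xy finset.setUC eqxx xpair_eqE eq_sym (negbTE xy).
rewrite finset.setUC big1 ?addr0 // => -[i k] /=.
rewrite !xpair_eqE => /andP[/andP[/andP[ki /eqP/setP E] n1] n2].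
have := E i; have := E k; have := E x; have := E y; rewrite !inE !eqxx ?orbT.
move: ki n1 n2; rewrite (eq_sym y i) (eq_sym y k) (eq_sym x i) (eq_sym x k).
have [->|ix] := eqVneq i x; have [->|ky] := eqVneq k y => //=.
all: have [E1|] := eqVneq i y; have [E2|] := eqVneq k x => //=; subst.
all: by rewrite ?eqxx.
Qed.

(** The logarithmic derivative of a split polynomial at 1. *)
Lemma coef1_prod_shift (F : fieldType) (s : seq F) :
  let H := \prod_(z <- s) ('X - z%:P) \Po ('X + 1%:P) in
  H`_0 != 0 -> H`_1 = H`_0 * \sum_(z <- s) (1 - z)^-1.
Proof.
elim: s => [|z s IH] /=.
  by rewrite !big_nil comp_polyC coefC /= mulr0 !coefC.
rewrite !big_cons comp_polyM.
set H := (\prod_(_ <- _) _ \Po _) in IH *.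
have -> : ('X - z%:P) \Po ('X + 1%:P) = 'X + (1 - z)%:P.
  by rewrite comp_polyB comp_polyX comp_polyC rmorphB /= addrA.
rewrite mulrDl !coefD !coefXM !coefCM /= add0r mulf_eq0 negb_or => /andP[z1 H0].
rewrite IH // mulrDr; congr (_ + _); last by rewrite mulrA.
by rewrite mulrAC divff // mul1r.
Qed.

(** One root 1 accounts for the vanishing constant coefficient.  Dividing it
    out leaves a polynomial whose two lowest coefficients in X - 1 are [G`_1]
    and [G`_2]. *)
Lemma kemeny_coef (R : realType) (n : nat) (T : 'M[R]_n)
    (G := char_poly T \Po ('X + 1%:P)) :
  G`_0 = 0 -> G`_1 != 0 -> kemeny T = G`_2 / G`_1.
Proof.
move=> G0 G1; pose c := real_complex R.
pose H := \prod_(z <- rem 1 (eigenvalues T)) ('X - z%:P) \Po ('X + 1%:P).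
have root1 : 1 \in eigenvalues T.
  rewrite -root_prod_XsubC -eigenvaluesP -map_char_poly rootE.
  rewrite -[X in _.[X]](rmorph1 c) horner_map /= /c.
  suff -> : (char_poly T).[1] = 0 by rewrite rmorph0.
  by rewrite -[RHS]G0 /G -horner_coef0 horner_comp !hornerE.
have GH : map_poly c G = 'X * H.
  rewrite /G map_comp_poly map_char_poly eigenvaluesP.
  rewrite (perm_big _ (perm_to_rem root1)) big_cons comp_polyM /H.
  congr (_ * _).
    rewrite comp_polyB comp_polyX comp_polyC rmorphD /= map_polyX map_polyC /=.
    by rewrite rmorph1 addrK.
  by rewrite rmorphD /= map_polyX map_polyC /= rmorph1.
have Gc k : (map_poly c G)`_k = c G`_k by rewrite coef_map.
have H0 : H`_0 = c G`_1 by rewrite -Gc GH coefXM.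
have H1 : H`_1 = c G`_2 by rewrite -Gc GH coefXM.
have H0n : H`_0 != 0 by rewrite H0 fmorph_eq0.
have := coef1_prod_shift H0n; rewrite -kemenyE -/H H0 H1 -rmorphM.
by move=> /(fmorph_inj c) ->; rewrite mulrAC divff ?mul1r.
Qed.

(** * The inequality for one map *)

(** Both sides are sums of b_i b_k b_j over i != k and all j, weighted by
    m2 i k on the right and by m1 j on the left.  In the terms with j != i the
    roles of j and k on the left can be exchanged, turning m1 j into m1 k, while
    the terms with j = i carry m1 i.  After this rearrangement the comparison
    holds term by term. *)
Lemma pair_average (R : realFieldType) (I : finType) (b m1 : I -> R)
    (m2 : I -> I -> R) (b_gt0 : forall i, 0 < b i)
    (m2C : forall i k, m2 i k = m2 k i) (m12 : forall i k, m1 i <= m2 i k) :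
  (\sum_i b i * m1 i) * (\sum_i \sum_(k | k != i) b i * b k)
    <= (\sum_i \sum_(k | k != i) b i * b k * m2 i k) * (\sum_i b i)
    ?= iff [forall i, forall (k | k != i), m2 i k == m1 i].
Proof.
pose m i k j := m1 (if j == i then i else k).
have -> : (\sum_i b i * m1 i) * (\sum_i \sum_(k | k != i) b i * b k)
  = \sum_i \sum_(k | k != i) \sum_j b i * b k * m i k j * b j.
  transitivity (\sum_i \sum_(k | k != i) \sum_j b i * b k * m1 j * b j).
    rewrite mulrC big_distrl; apply: eq_bigr => i _.
    rewrite big_distrl; apply: eq_bigr => k _; rewrite big_distrr /=.
    by apply: eq_bigr => j _; rewrite -!mulrA (mulrC (b j)).
  (* When j differs from i, exchanging j and k turns one sum into the other. *)
  apply: eq_bigr => i _; rewrite [RHS](eq_bigr (fun k => b i * b k * m1 i * b i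
      + \sum_(j | j != i) b i * b k * m1 k * b j)) => [|k _]; last first.
    rewrite (bigD1 i) //= /m eqxx; congr (_ + _).
    by apply: eq_bigr => j /negbTE ->.
  rewrite [LHS](eq_bigr (fun k => b i * b k * m1 i * b i
      + \sum_(j | j != i) b i * b k * m1 j * b j)) => [|k _]; last first.
    by rewrite (bigD1 i).
  rewrite !big_split /= [in LHS]exchange_big /=; congr (_ + _).
  by apply: eq_bigr => k _; apply: eq_bigr => j _; ring.
have -> : [forall i, forall (k | k != i), m2 i k == m1 i]
  = [forall i, forall (k | k != i), forall j, m i k j == m2 i k].
  apply/idP/idP => /forallP E; apply/forallP => i; apply/forall_inP => k ki.
    apply/forallP => j; rewrite /m eq_sym; case: (j == i).
      exact: (forall_inP (E i)).
    by rewrite m2C (forall_inP (E k)) // eq_sym.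
  by have /forallP/(_ i) := forall_inP (E i) k ki; rewrite /m eqxx eq_sym.
rewrite big_distrl; apply: leif_sum => i _.
rewrite big_distrl; apply: leif_sum => k _.
rewrite big_distrr; apply: leif_sum => j _.
have mle : m i k j <= m2 i k by rewrite /m; case: (j == i); rewrite // m2C.
have bb : 0 < b i * b k by rewrite mulr_gt0.
split; first by rewrite ler_pM2r ?ler_pM2l.
by rewrite (inj_eq (mulIf (lt0r_neq0 _))) // (inj_eq (mulfI (lt0r_neq0 _))).
Qed.

Lemma rooted1P (I : finType) (g : I -> I) (i : I) :
  reflect (forall j, fconnect g j i) (rooted g [set i]%SET).
Proof.
apply: (iffP forallP) => h j; have := h j; rewrite /reaches.
  by case/existsP => r /andP[]; rewrite inE => /eqP ->.
by move=> ji; apply/existsP; exists i; rewrite inE eqxx.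
Qed.

Lemma rootedS (I : finType) (g : I -> I) (A B : {set I}) :
  A \subset B -> rooted g A -> rooted g B.
Proof.
move=> /fintype.subsetP AB /forallP gA; apply/forallP => i.
have /existsP[r /andP[/AB rB ir]] := gA i.
by apply/existsP; exists r; rewrite rB.
Qed.

(** Following [g] from g i back to i exhibits a preimage of i, so [g] is
    surjective. *)
Lemma rooted_all_inj (I : finType) (g : I -> I) :
  (forall i, rooted g [set i]%SET) -> injective g.
Proof.
move=> gI; have surj i : exists x, g x == i.
  have /rooted1P/(_ (g i))/iter_findex := gI i.
  by rewrite -iterSr /= => E; eexists; apply/eqP; exact: E.
pose h i := xchoose (surj i).
have hK : cancel h g by move=> i; apply/eqP; apply: (xchooseP (surj i)).
have [h' h'K hK'] := injF_bij (can_inj hK).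
by move=> x y; rewrite -(hK' x) -(hK' y) !hK => ->.
Qed.

(** The probability of [g] when g i is drawn independently with law S(i, .). *)
Definition weight (R : realFieldType) (n : nat) (S : 'M[R]_n)
  (g : 'I_n -> 'I_n) : R := \prod_i S i (g i).

Definition root_sum (R : realFieldType) (n : nat) (b : 'I_n -> R)
  (g : 'I_n -> 'I_n) : R := \sum_i b i * (rooted g [set i]%SET)%:R.

Definition root_pair_sum (R : realFieldType) (n : nat) (b : 'I_n -> R)
    (g : 'I_n -> 'I_n) : R :=
  \sum_i \sum_(k | k != i) b i * b k * (rooted g [set i; k]%SET)%:R.

(** The equality case of the inequality for one map. *)
Definition pairs_agree (I : finType) (g : I -> I) : bool :=
  [forall i, forall (k | k != i),
     rooted g [set i; k]%SET == rooted g [set i]%SET].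

(** The chain that leaves i with probability [a i] and then jumps according
    to [S]. *)
Definition lazy_mx (R : realFieldType) (n : nat) (a : 'I_n -> R)
    (S : 'M[R]_n) : 'M[R]_n :=
  \matrix_(i, j) ((i == j)%:R - a i * ((i == j)%:R - S i j)).

Lemma prod_notin (R : realFieldType) (I : finType) (a : I -> R) (A : {set I}) :
  (forall i, 0 < a i) ->
  \prod_(i | i \notin A) a i = (\prod_i a i) * \prod_(i in A) (a i)^-1.
Proof.
move=> a0; rewrite (bigID (mem A) predT) /= mulrAC -big_split /=.
by rewrite [X in X * _]big1 ?mul1r // => i _; rewrite divff ?lt0r_neq0.
Qed.

Lemma root_pair_leif (R : realFieldType) (n : nat) (b : 'I_n -> R)
    (g : 'I_n -> 'I_n) (b_gt0 : forall i, 0 < b i) :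
  root_sum b g * (\sum_i \sum_(k | k != i) b i * b k)
    <= root_pair_sum b g * (\sum_i b i) ?= iff pairs_agree g.
Proof.
have -> : pairs_agree g = [forall i, forall (k | k != i),
     (rooted g [set i; k]%SET)%:R == (rooted g [set i]%SET)%:R :> R].
  by apply: eq_forallb => i; apply: eq_forallb => k;
     rewrite eqr_nat; do 2!case: (rooted _ _).
apply: (pair_average (m1 := fun i => (rooted g [set i]%SET)%:R)
  (m2 := fun i k => (rooted g [set i; k]%SET)%:R)) => // i k.
  by rewrite finset.setUC.
rewrite ler_nat; have := @rootedS _ g [set i]%SET [set i; k]%SET.
by rewrite finset.subsetUl; do 2!case: (rooted _ _) => //; move=> /(_ isT isT).
Qed.

(** The second coefficient is doubled because [root_pair_sum] runs over ordered
    pairs. *)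
Lemma coef_lazy (R : realFieldType) (n : nat) (a : 'I_n -> R) (S : 'M[R]_n)
    (a_gt0 : forall i, 0 < a i) (S1 : forall i, \sum_j S i j = 1)
    (G := char_poly (lazy_mx a S) \Po ('X + 1%:P)) (b := fun i => (a i)^-1) :
  [/\ (0 < n)%N -> G`_0 = 0,
      G`_1 = (\prod_i a i) * \sum_(g : {ffun 'I_n -> 'I_n})
                               weight S g * root_sum b g
    & G`_2 *+ 2 = (\prod_i a i) * \sum_(g : {ffun 'I_n -> 'I_n})
                               weight S g * root_pair_sum b g].
Proof.
have E k := coef_char_poly_shift S1 (fun i j => mxE _ _ i j) k.
split => [n_gt0||].
- rewrite /G E big1 // => g _; rewrite [X in _ * X]big1 ?mulr0 // => A.
  rewrite cards_eq0 => /eqP ->; suff -> : rooted g finset.set0 = false.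
    by rewrite mulr0.
  apply/negP => /forallP/(_ (Ordinal n_gt0))/existsP[r].
  by rewrite inE.
- rewrite /G E big_distrr; apply: eq_bigr => g _ /=; rewrite mulrCA.
  congr (_ * _); rewrite /root_sum mulr_sumr.
  rewrite -big_card1; apply: eq_bigr => i _.
  by rewrite prod_notin // big_set1 -!mulrA.
- rewrite /G E -sumrMnl big_distrr; apply: eq_bigr => g _ /=.
  rewrite mulrCA -mulrnAr -big_card2; congr (_ * _).
  rewrite mulr_sumr; apply: eq_bigr => i _; rewrite mulr_sumr.
  apply: eq_bigr => k ki; rewrite prod_notin // big_setU1 ?inE 1?eq_sym //=.
  by rewrite big_set1 -!mulrA.
Qed.

Lemma root_sum_ge0 (R : realFieldType) (n : nat) (b : 'I_n -> R)
    (g : 'I_n -> 'I_n) : (forall i, 0 < b i) -> 0 <= root_sum b g.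
Proof. by move=> b0; apply: sumr_ge0 => i _; rewrite mulr_ge0 ?ler0n ?ltW. Qed.

Lemma weight_ge0 (R : realFieldType) (n : nat) (S : 'M[R]_n)
    (g : 'I_n -> 'I_n) :
  (forall i j, 0 <= S i j) -> 0 <= weight S g.
Proof. by move=> S0; apply: prodr_ge0. Qed.

(** * The lower bound and its equality case *)

(** The sum of b_i b_k over i < k, divided by the sum of b_i; the factor 2
    compensates for ordered pairs. *)
Definition kemeny_bound (R : realFieldType) (n : nat) (b : 'I_n -> R) : R :=
  (\sum_i \sum_(k | k != i) b i * b k) / (2 * \sum_i b i).

(** The map [g0] witnesses that the denominator, the mean of [root_sum], is
    positive; the bound is then the average over [g] of [root_pair_leif]. *)
Lemma kemeny_lazy_leif (R : realType) (n : nat) (a : 'I_n -> R) (S : 'M[R]_n)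
    (b := fun i => (a i)^-1) (g0 : {ffun 'I_n -> 'I_n}) (i0 : 'I_n)
    (a_gt0 : forall i, 0 < a i) (S0 : forall i j, 0 <= S i j)
    (S1 : forall i, \sum_j S i j = 1)
    (g0_gt0 : 0 < weight S g0) (g0_rooted : rooted g0 [set i0]%SET) :
  kemeny_bound b <= kemeny (lazy_mx a S)
    ?= iff [forall g : {ffun 'I_n -> 'I_n}, (0 < weight S g) ==> pairs_agree g].
Proof.
have n_gt0 : (0 < n)%N := leq_ltn_trans (leq0n i0) (ltn_ord i0).
have b_gt0 i : 0 < b i by rewrite invr_gt0.
have [/(_ n_gt0) G0 G1 G2] := coef_lazy a_gt0 S1.
set w1 := \sum_g _ in G1; set w2 := \sum_g _ in G2.
have pa_gt0 : 0 < \prod_i a i by apply: prodr_gt0.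
have w1_gt0 : 0 < w1.
  rewrite /w1 (bigD1 g0) //= ltr_wpDr //.
    by apply: sumr_ge0 => g _; rewrite mulr_ge0 ?weight_ge0 ?root_sum_ge0.
  rewrite mulr_gt0 // /root_sum -/b (bigD1 i0) // g0_rooted mulr1 ltr_wpDr //;
    last exact: b_gt0.
  by apply: sumr_ge0 => i _; rewrite mulr_ge0 ?ler0n // ltW // b_gt0.
have B_gt0 : 0 < \sum_i b i.
  rewrite (bigD1 i0) //; apply: ltr_wpDr; last exact: b_gt0.
  by apply: sumr_ge0 => i _; rewrite ltW // b_gt0.
have -> : kemeny (lazy_mx a S) = w2 / (2 * w1).
  rewrite kemeny_coef // ?G1; last by rewrite mulf_neq0 ?lt0r_neq0.
  apply/eqP; rewrite eqr_div ?mulf_neq0 ?lt0r_neq0 ?ltr0n //.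
  by rewrite mulrA mulr_natr G2 mulrAC mulrC.
rewrite /kemeny_bound; set e2 := \sum_i \sum_(k | _) _; set B := \sum_i b i.
have -> : (e2 / (2 * B) <= w2 / (2 * w1) ?= iff
   [forall g : {ffun 'I_n -> 'I_n}, (0 < weight S g) ==> pairs_agree g])
  = (w1 * e2 <= w2 * B ?= iff
   [forall g : {ffun 'I_n -> 'I_n}, (0 < weight S g) ==> pairs_agree g]).
  rewrite /Order.leif ler_pdivrMr ?mulr_gt0 // mulrAC ler_pdivlMr ?mulr_gt0 //.
  rewrite eqr_div ?mulf_neq0 ?lt0r_neq0 ?ltr0n //.
  have -> : e2 * (2 * w1) = 2 * (w1 * e2) by ring.
  have -> : w2 * (2 * B) = 2 * (w2 * B) by ring.
  by rewrite ler_pM2l // (inj_eq (mulfI _)) // pnatr_eq0.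
rewrite !big_distrl /=; apply: leif_sum => g _; rewrite -!mulrA.
have [g_gt0|] := boolP (0 < weight S g) => /=.
  have [le1 eq1] := root_pair_leif g b_gt0.
  by split; [rewrite ler_pM2l | rewrite (inj_eq (mulfI (lt0r_neq0 g_gt0)))].
rewrite lt_def weight_ge0 // andbT negbK => /eqP ->; rewrite !mul0r.
exact: leif_refl.
Qed.

(** Passing through the pair {i, k}, being rooted at i forces being rooted
    at k. *)
Lemma hamiltonian_of_agree (I : finType) (g : I -> I) (i : I) :
  pairs_agree g -> rooted g [set i]%SET -> forall k, rooted g [set k]%SET.
Proof.
move=> /forallP gP gi k; have [->//|ki] := eqVneq k i.
have ik : i != k by rewrite eq_sym.
have := forall_inP (gP k) i ik; rewrite finset.setUC => /eqP <-.
by have := forall_inP (gP i) k ki => /eqP ->.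
Qed.

Lemma agree_of_hamiltonian (I : finType) (g : I -> I) :
  (forall i, rooted g [set i]%SET) -> pairs_agree g.
Proof.
move=> gI; apply/forallP => i; apply/forall_inP => k _; rewrite gI.
by rewrite (rootedS (finset.subsetUl _ _) (gI i)).
Qed.

(** Redirecting i in the Hamiltonian cycle [g0] to another vertex j that [S]
    allows gives a map [g1] of positive weight that is still rooted at i, since
    the path of [g0] from any vertex to i is unchanged.  So [g1] is again a
    permutation, although i and the predecessor of j under [g0] have the same
    image. *)
Lemma support_hamiltonian (R : realFieldType) (n : nat) (S : 'M[R]_n)
    (g0 : {ffun 'I_n -> 'I_n}) (S0 : forall i j, 0 <= S i j)
    (S1 : forall i, \sum_j S i j = 1) (g0_gt0 : 0 < weight S g0)
    (g0H : forall i, rooted g0 [set i]%SET)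
    (agree : forall g : {ffun 'I_n -> 'I_n}, 0 < weight S g -> pairs_agree g) :
  forall i j, S i j = (g0 i == j)%:R.
Proof.
have Sg0 i : 0 < S i (g0 i).
  rewrite lt_def S0 andbT; apply: contraTneq g0_gt0 => Si0.
  by rewrite /weight (bigD1 i) //= Si0 mul0r ltxx.
have off i j : j != g0 i -> S i j = 0.
  move=> jg; apply/eqP/negPn/negP => Sij.
  pose g1 : {ffun 'I_n -> 'I_n} := [ffun x => if x == i then j else g0 x].
  have g1_gt0 : 0 < weight S g1.
    apply: prodr_gt0 => x _; rewrite ffunE; have [->|//] := eqVneq x i.
    by rewrite lt_def Sij S0.
  have g1i : rooted g1 [set i]%SET.
    apply/forallP => x; have /rooted1P/(_ x)/iter_findex := g0H i.
    move: (findex g0 x i) => m; elim: m x => [x /= ->|m IH x].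
      by rewrite reaches_root ?inE.
    rewrite iterSr => /IH.
    have [->|xi] := eqVneq x i; first by rewrite (reaches_root _ (set11 i)).
    by rewrite [in X in _ -> X]reaches_step ?inE // ffunE (negbTE xi).
  have g1inj := rooted_all_inj (hamiltonian_of_agree (agree _ g1_gt0) g1i).
  have [h hK Kh] := injF_bij (rooted_all_inj g0H).
  have hji : h j != i by apply: contraNneq jg => <-; rewrite Kh.
  have := g1inj (h j) i; rewrite !ffunE eqxx (negbTE hji) Kh.
  by move=> /(_ erefl)/eqP; rewrite (negbTE hji).
move=> i j; have [<-|gj] := eqVneq (g0 i) j; last by rewrite off // eq_sym.
by rewrite -[RHS](S1 i) (bigD1 (g0 i)) //= big1 ?addr0 // => k /off.
Qed.

(** * Essential classes and spanning trees *)

(** Among the vertices reachable from j, take k with as few descendants as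
    possible.  The descendants of k form an essential class, hence the only one,
    so every j leads to it. *)
Lemma single_class_root (R : realType) (n : nat) (T : 'M[R]_n) :
  single_essential_class T -> exists i0, forall j, connect (Defs.arc T) j i0.
Proof.
move=> /cards1P[C /setP CE].
have CP U : essential_class T U -> U = C.
  by move=> eU; have := CE U; rewrite !inE eU => /esym/eqP.
have /and4P[/finset.set0Pn[i0 i0C] _ _ _] : essential_class T C.
  by have := CE C; rewrite !inE eqxx.
exists i0 => j; pose reach k := [set l | connect (Defs.arc T) k l]%SET.
have reachP k l : (l \in reach k) = connect (Defs.arc T) k l by rewrite inE.
case: (@arg_minnP _ j (connect (Defs.arc T) j) (fun k => #|reach k|)).
  exact: connect0.
move=> k jk kmin.
have back l : connect (Defs.arc T) k l -> connect (Defs.arc T) l k.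
  move=> kl; have sub : reach l \subset reach k.
    by apply/fintype.subsetP => m; rewrite !reachP; apply: connect_trans.
  have : reach l == reach k by rewrite eqEcard sub kmin ?(connect_trans jk).
  by move=> /eqP/setP/(_ k); rewrite !reachP connect0.
have : essential_class T (reach k).
  apply/and4P; split.
  - by apply/finset.set0Pn; exists k; rewrite reachP.
  - apply/forall_inP => l; rewrite reachP => kl; apply/forallP => m.
    apply/implyP => lm; apply: (connect_trans _ kl).
    by apply/back/(connect_trans kl).
  - apply/forall_inP => l; rewrite reachP => kl.
    apply/forall_inP => m; rewrite reachP => km.
    exact: connect_trans (back _ kl) km.
  - apply/forall_inP => l; rewrite reachP => kl; apply/forallP => m.
    by apply/implyP => lm; rewrite reachP (connect_trans kl).
move=> /CP E; apply: connect_trans jk _; rewrite -reachP E.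
exact: i0C.
Qed.

(** Each vertex other than [i0] is sent to an out-neighbour that is strictly
    closer to [i0]. *)
Lemma connected_tree (I : finType) (e : rel I) (i0 : I) :
  (forall i, exists j, e i j) -> (forall j, connect e j i0) ->
  exists g : {ffun I -> I}, (forall i, e i (g i)) /\ rooted g [set i0]%SET.
Proof.
move=> out conn.
have dex j : exists m, [exists p : m.-tuple I, path e j p && (last j p == i0)].
  have /connectP[p ep lp] := conn j.
  by exists (size p); apply/existsP; exists (in_tuple p); rewrite ep lp eqxx.
pose dist j := ex_minn (dex j).
have closer j : j != i0 -> exists k, e j k && (dist k < dist j)%N.
  move=> ji0; rewrite /dist; case: (ex_minnP (dex j)) => m.
  move=> /existsP[p /andP[]].
  case: m p => [|m] p; first by rewrite tuple0 /= (negbTE ji0).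
  case/tupleP: p => k p /= /andP[jk kp] lp _; exists k; rewrite jk /=.
  case: ex_minnP => q _ /(_ m); apply.
  by apply/existsP; exists p; rewrite kp.
pose g := [ffun j => if j == i0 then xchoose (out j)
  else odflt j [pick k | e j k && (dist k < dist j)%N]].
have gP j : j != i0 -> e j (g j) && (dist (g j) < dist j)%N.
  move=> ji0; rewrite ffunE (negbTE ji0); case: pickP => //= h.
  by have [k] := closer _ ji0; rewrite h.
exists g; split=> [i|].
  have [->|/gP/andP[]//] := eqVneq i i0.
  by rewrite ffunE eqxx (xchooseP (out i0)).
apply/forallP => j; have [m] := ubnP (dist j); elim: m j => // m IH j.
have [->|ji0] := eqVneq j i0; first by rewrite reaches_root ?inE.
rewrite ltnS => jm; rewrite reaches_step ?inE //; apply: IH.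
by have /andP[_ lt] := gP _ ji0; apply: leq_trans lt jm.
Qed.

(** * Hamiltonian permutations and completions *)

Lemma porbits_hamiltonian (n : nat) (s : 'S_n) :
  porbits s = [set [set: 'I_n]]%SET
    <-> (0 < n)%N /\ (forall i, rooted s [set i]%SET).
Proof.
split => [sE|[n0 sH]].
  split.
    have : [set: 'I_n]%SET \in porbits s by rewrite sE inE.
    by case/imsetP => i _ _; apply: leq_ltn_trans (ltn_ord i).
  move=> i; apply/rooted1P => j.
  have : porbit s j \in porbits s by apply: imset_f.
  rewrite sE inE => /eqP/setP/(_ i); rewrite finset.in_setT => /porbitP[m ->].
  by rewrite permX fconnect_iter.
have full i : porbit s i = [set: 'I_n]%SET.
  apply/setP => j; rewrite [RHS]finset.in_setT; apply/porbitP.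
  have /rooted1P/(_ i)/iter_findex <- := sH j.
  by exists (findex s i j); rewrite permX.
apply/setP => A; rewrite inE; apply/imsetP/eqP => [[i _ ->]//|->].
by exists (Ordinal n0).
Qed.

Lemma exists_hamiltonian (n : nat) :
  exists s : 'S_n, forall i, rooted s [set i]%SET.
Proof.
exists (perm (@ordS_inj n)) => i; apply/rooted1P => j.
have -> : i = iter (i + (n - j))%N (perm (@ordS_inj n)) j.
  have itE m : iter m (perm (@ordS_inj n)) j = ((j + m) %% n)%N :> nat.
    elim: m => [|m IH]; first by rewrite addn0 modn_small.
    by rewrite iterS permE /= IH -addn1 modnDml addn1 addnS.
  apply: val_inj; rewrite /= itE addnCA subnKC ?(ltnW (ltn_ord j)) //.
  by rewrite modnDr modn_small.
exact: fconnect_iter.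
Qed.

Lemma stochastic_pos (R : realType) (n : nat) (S : 'M[R]_n) (i : 'I_n) :
  stochastic S -> exists j, 0 < S i j.
Proof.
move=> [S0 S1]; apply/existsP; apply: contraT => /existsPn h.
have := S1 i; rewrite big1 => [/esym/eqP|j _]; first by rewrite oner_eq0.
by apply/eqP; move: (h j); rewrite lt_def S0 andbT negbK.
Qed.

(** [S] is the law of the jump conditioned on leaving the current state. *)
Lemma lazy_jump (R : realType) (n : nat) (a : 'I_n -> R) (T : 'M[R]_n) :
    (forall i, 0 < a i) -> (forall i, T i i = 1 - a i) -> stochastic T ->
  exists2 S : 'M[R]_n, stochastic S & T = lazy_mx a S.
Proof.
move=> a0 Ti [T0 T1].
exists (\matrix_(i, j) (if i == j then 0 else T i j / a i)).
  split=> [i j|i].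
    by rewrite mxE; case: eqP => // _; rewrite divr_ge0 // ltW.
  rewrite (bigD1 i) //= mxE eqxx add0r.
  transitivity ((\sum_(j | j != i) T i j) / a i).
    rewrite mulr_suml; apply: eq_bigr => j ji.
    by rewrite mxE eq_sym (negbTE ji).
  have := T1 i; rewrite (bigD1 i) //= Ti => E.
  have -> : \sum_(j | j != i) T i j = a i by lra.
  by rewrite divff ?lt0r_neq0.
apply/matrixP => i j; rewrite !mxE; case: eqP => [->|_] /=.
  by rewrite subr0 mulr1 Ti.
by rewrite !sub0r mulrN opprK mulrC divfK ?lt0r_neq0.
Qed.

(** The arcs of the lazy matrix and of [S] differ only by loops. *)
Lemma single_class_tree (R : realType) (n : nat) (a : 'I_n -> R) (S : 'M[R]_n) :
    stochastic S -> (forall i, 0 < a i) ->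
    single_essential_class (lazy_mx a S) ->
  exists (g : {ffun 'I_n -> 'I_n}) i, 0 < weight S g /\ rooted g [set i]%SET.
Proof.
move=> stoS a0 /single_class_root[i0 conn].
have [] := @connected_tree _ (fun i j => 0 < S i j) i0.
- by move=> i; apply: stochastic_pos.
- move=> j; apply: connect_sub (conn j) => {}j k; rewrite /Defs.arc mxE.
  have [->|jk] := eqVneq j k; first by rewrite connect0.
  by rewrite !sub0r mulrN opprK pmulr_rgt0 // => h; apply: connect1.
by move=> g [gS gr]; exists g, i0; split=> //; apply: prodr_gt0.
Qed.

Lemma single_class_hamiltonian (R : realType) (n : nat) (T : 'M[R]_n)
    (s : 'S_n) : (0 < n)%N -> (forall i, rooted s [set i]%SET) ->
  (forall i, 0 < T i (s i)) -> single_essential_class T.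
Proof.
move=> n0 sH Ts.
have conn i j : connect (Defs.arc T) i j.
  have /rooted1P/(_ i) := sH j; apply: connect_sub => {}i {}j /eqP <-.
  exact: connect1 (Ts i).
apply/cards1P; exists [set: 'I_n]%SET; apply/setP => U; rewrite !inE.
apply/idP/eqP => [/and4P[/finset.set0Pn[i iU] _ _ UC]|->].
  apply/setP => j; rewrite finset.in_setT.
  by have /forallP/(_ j) := forall_inP UC i iU; rewrite conn.
apply/and4P; split.
- by apply/finset.set0Pn; exists (Ordinal n0); rewrite finset.in_setT.
- by apply/forall_inP => i _; apply/forallP => j; rewrite !conn.
- by apply/forall_inP => i _; apply/forall_inP => j _.
- apply/forall_inP => i _; apply/forallP => j.
  by rewrite finset.in_setT implybT.
Qed.

Lemma lazy_mxE (R : realFieldType) (n : nat) (d : 'rV[R]_n) (C : 'M[R]_n) :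
  diag_mx d + (1%:M - diag_mx d) *m C = lazy_mx (fun i => 1 - d 0 i) C.
Proof.
apply/matrixP => i j; rewrite mulmxBl mul1mx mul_diag_mx !mxE.
by case: eqP => [->|_] /=; rewrite ?mulr1n ?mulr0n; ring.
Qed.

Lemma stochastic_lazy (R : realType) (n : nat) (a : 'I_n -> R) (S : 'M[R]_n) :
  (forall i, 0 < a i <= 1) -> stochastic S -> stochastic (lazy_mx a S).
Proof.
move=> a01 [S0 S1]; split=> [i j|i].
  have /andP[a0 a1] := a01 i; have aS := mulr_ge0 (ltW a0) (S0 i j).
  by rewrite mxE; case: (i == j) => /=; lra.
under eq_bigr do rewrite mxE.
rewrite sumrB -mulr_sumr sumrB S1 (bigD1 i) //= eqxx big1 ?addr0; last first.
  by move=> j ji; rewrite eq_sym (negbTE ji).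
by rewrite subrr mulr0 subr0.
Qed.

Lemma stochastic_perm (R : realType) (n : nat) (s : 'S_n) :
  stochastic (perm_mx s : 'M[R]_n).
Proof.
split=> [i j|i]; first by rewrite !mxE ler0n.
rewrite (bigD1 (s i)) //= !mxE eqxx big1 ?addr0 // => j ji.
by rewrite !mxE eq_sym (negbTE ji).
Qed.

Lemma weight_perm (R : realFieldType) (n : nat) (s : 'S_n)
    (g : {ffun 'I_n -> 'I_n}) :
  0 < weight (perm_mx s : 'M[R]_n) g -> g =1 s.
Proof.
move=> g0 i; apply/eqP/negPn/negP => gi; move: g0.
by rewrite /weight (bigD1 i) //= !mxE eq_sym (negbTE gi) mul0r ltxx.
Qed.

Lemma rooted_ext (I : finType) (g h : I -> I) (A : {set I}) :
  g =1 h -> rooted g A = rooted h A.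
Proof.
move=> gh; apply: eq_forallb => i; apply: eq_existsb => r.
by rewrite (eq_fconnect gh).
Qed.

Lemma kemeny_hamiltonian (R : realType) (n : nat) (a : 'I_n -> R) (s : 'S_n) :
    (0 < n)%N -> (forall i, 0 < a i) -> (forall i, rooted s [set i]%SET) ->
  kemeny (lazy_mx a (perm_mx s)) = kemeny_bound (fun i => (a i)^-1).
Proof.
move=> n0 a0 sH; have [S0 S1] := stochastic_perm R s.
pose g : {ffun 'I_n -> 'I_n} := [ffun i => s i].
have gs : g =1 s by move=> i; rewrite ffunE.
have g0 : 0 < weight (perm_mx s : 'M[R]_n) g.
  by apply: prodr_gt0 => i _; rewrite !mxE gs eqxx.
have gr : rooted g [set Ordinal n0]%SET by rewrite (rooted_ext _ gs).
have [_] := kemeny_lazy_leif a0 S0 S1 g0 gr.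
have -> : [forall h : {ffun 'I_n -> 'I_n},
    (0 < weight (perm_mx s : 'M[R]_n) h) ==> pairs_agree h].
  apply/forallP => h; apply/implyP => /weight_perm hs.
  by apply: agree_of_hamiltonian => i; rewrite (rooted_ext _ hs).
by move=> /eqP.
Qed.

(** With a single index, the row would be fully specified with sum [d 0 i],
    which is less than 1. *)
Lemma exists_neq (R : realType) (n : nat) (d : 'rV[R]_n) (P : 'M[option R]_n)
    (hd : forall j, 0 <= d 0 j < 1) (hP : partial_stochastic P)
    (hPd : forall i j, P i j = if i == j then Some (d 0 j) else None)
    (i : 'I_n) : exists j, j != i.
Proof.
apply/existsP; apply: contraT => /existsPn all_i.
have iE j : j = i by apply/eqP; rewrite -[_ == _]negbK all_i.
have full : fully_specified P i by move=> j; rewrite (iE j) /specified hPd eqxx.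
have := specified_sum_full hP full.
rewrite /specified_sum (bigD1 i) ?full //= big1 ?addr0 => [|j].
  by rewrite hPd eqxx /= => E; have := hd i; rewrite E ltxx andbF.
by rewrite (iE j) eqxx andbF.
Qed.

Unset Implicit Arguments.

Theorem theorem3p11 (R : realType) (n : nat) (d : 'rV[R]_n)
    (P : 'M[option R]_n) (T : 'M[R]_n)
    (hd : forall j, 0 <= d 0 j < 1)
    (hP : partial_stochastic P)
    (hPd : forall i j, P i j = if i == j then Some (d 0 j) else None) :
  let D := diag_mx d in
  [/\ SC P T, single_essential_class T & (kemeny T)%:E = kemeny_inf P] <->
  exists C : 'M[R]_n, cyclic_perm_mx C /\ T = D + (1%:M - D) *m C.
Proof.
move=> D; rewrite {}/D; pose a i := 1 - d 0 i; pose b i := (a i)^-1.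
have a0 i : 0 < a i by rewrite subr_gt0; case/andP: (hd i).
have a1 i : a i <= 1 by rewrite gerBl; case/andP: (hd i).
have lazyP M : SC P M -> exists2 S, stochastic S & M = lazy_mx a S.
  move=> [cM sM]; apply: lazy_jump => // i; rewrite /a subKr.
  by apply: cM; rewrite hPd eqxx.
have bound M : SC P M -> single_essential_class M -> kemeny_bound b <= kemeny M.
  move=> /lazyP[S sS ->] /(single_class_tree sS a0)[g [i [g0 gr]]].
  by have [S0 S1] := sS; apply: (kemeny_lazy_leif a0 S0 S1 g0 gr).
have ham (s : 'S_n) : (0 < n)%N -> (forall i, rooted s [set i]%SET) ->
  [/\ SC P (lazy_mx a (perm_mx s)),
      single_essential_class (lazy_mx a (perm_mx s))
    & kemeny (lazy_mx a (perm_mx s)) = kemeny_bound b].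
  move=> n0 sH; have sS := stochastic_perm R s.
  have sfree i : s i != i.
    have [j ji] := exists_neq hd hP hPd i.
    apply: contraNneq ji => si; have /rooted1P/(_ i)/iter_findex := sH j.
    have itm m : iter m s i = i by elim: m => //= m ->.
    by rewrite itm => ->.
  split; last exact: kemeny_hamiltonian.
    split; last by apply: stochastic_lazy => // i; rewrite a0 a1.
    move=> i j x; rewrite hPd; case: eqP => // <- [<-].
    by rewrite !mxE eqxx (negbTE (sfree i)) /a /=; ring.
  apply: (single_class_hamiltonian n0 sH) => i.
  rewrite !mxE eqxx eq_sym (negbTE (sfree i)) sub0r sub0r mulrN mulr1 opprK.
  exact: a0.
have infE : (0 < n)%N -> kemeny_inf P = (kemeny_bound b)%:E.
  move=> n0; apply/eqP; rewrite eq_le; apply/andP; split.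
    have [s sH] := exists_hamiltonian n; have [sP sc sK] := ham s n0 sH.
    apply: ereal_inf_lbound; exists (lazy_mx a (perm_mx s)) => //.
    by rewrite sK.
  apply: le_ereal_inf_tmp => _ [M [MP Mc] <-].
  by rewrite lee_fin bound.
split=> [[TP Tc TK]|[C [[s [sE ->]] ->]]].
  have [S sS TE] := lazyP T TP; have [S0 S1] := sS.
  rewrite TE in Tc; have [g [i [g0 gr]]] := single_class_tree sS a0 Tc.
  have n0 : (0 < n)%N by apply: leq_ltn_trans (ltn_ord i).
  have [_ /esym] := kemeny_lazy_leif a0 S0 S1 g0 gr.
  move: TK; rewrite (infE n0) TE => -[->]; rewrite eqxx => /forallP agree.
  have {}agree (h : {ffun 'I_n -> 'I_n}) : 0 < weight S h -> pairs_agree h.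
    exact: implyP (agree h).
  have gH := hamiltonian_of_agree (agree g g0) gr.
  have SE := support_hamiltonian S0 S1 g0 gH agree.
  pose s := perm (rooted_all_inj gH).
  exists (perm_mx s); split.
    exists s; split=> //; apply/porbits_hamiltonian; split=> // k.
    by rewrite (rooted_ext _ (permE (rooted_all_inj gH))).
  rewrite lazy_mxE; congr lazy_mx; apply/matrixP => k l.
  by rewrite SE !mxE permE.
have [n0 sH] := (porbits_hamiltonian s).1 sE; rewrite lazy_mxE.
by have [sP sc ->] := ham s n0 sH; rewrite infE.
Qed.
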